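(* Let $(Co_{\mathbf{K}},i)$ be an equational filter pair over $\Sigma$, with associated logic $l=(\Sigma,\vdash^X)$. If for every $\Sigma$-structure $A$ the map $i_A$ is surjective onto the collection of $l$-filters of $A$, then $l$ is truth-equational.
   Context: $Fm(X)$ is the absolutely free $\Sigma$-structure on a set $X$ of variables. A quasivariety is a class of $\Sigma$-structures axiomatizable by quasi-identities. $Co_{\mathbf{K}}(A)$ is the lattice of congruences $\theta$ on $A$ with $A/\theta\in\mathbf{K}$, ordered by inclusion. An equational filter pair is a pair $(Co_{\mathbf{K}},i)$ with $\mathbf{K}$ a quasivariety and $i_A:Co_{\mathbf{K}}(A)\to\mathcal{P}(A)$, $i_A(\theta)=\{a\in A\mid\langle\delta^A(a),\epsilon^A(a)\rangle\in\theta$ for all $\delta\approx\epsilon\in\tau\}$ for every $\Sigma$-structure $A$, where $\tau$ is a fixed finite set of equations in at most one variable. The associated logic $(\Sigma,\vdash^X)$: $\Gamma\vdash^X\varphi$ iff for all $\theta\in Co_{\mathbf{K}}(Fm(X))$, $\Gamma\subseteq i_{Fm(X)}(\theta)$ implies $\varphi\in i_{Fm(X)}(\theta)$. An $l$-filter on $A$ is a subset $F\subseteq A$ such that whenever $\Gamma\vdash^X\varphi$ and $v:Fm(X)\to A$ is a homomorphism with $v[\Gamma]\subseteq F$, then $v(\varphi)\in F$. An $l$-matrix is a pair $\langle A,F\rangle$ with $F$ an $l$-filter on $A$. A congruence $\theta$ on $A$ is compatible with $F\subseteq A$ if $a\in F$ and $\langle a,b\rangle\in\theta$ imply $b\in F$;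 $\Omega^A(F)$ is the largest congruence compatible with $F$. An $l$-matrix $\langle A,F\rangle$ is reduced if $\Omega^A(F)$ is the equality relation on $A$. A logic $l$ is truth-equational if there is a set $\tau'(p)$ of equations in one variable $p$ such that for every reduced $l$-matrix $\langle A,F\rangle$ and every $a\in A$: $a\in F$ iff $\delta^A(a)=\epsilon^A(a)$ for every $\delta\approx\epsilon\in\tau'(p)$. *)

(* Defs.v *)
From HB Require Import structures.
From mathcomp Require Import all_boot.
From mathcomp Require Import all_classical.

Set Implicit Arguments.
Unset Strict Implicit.
Unset Printing Implicit Defensive.

Local Open Scope classical_set_scope.
Local Open Scope quotient_scope.

(* [S n] is the type of n-ary operation symbols. *)
Definition signature := nat -> Type.

(* The carrier is allowed to be empty, so that Fm(X) is always a structure. *)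
Record structure (S : signature) := Structure {
  carrier :> Type;
  op : forall n, S n -> ('I_n -> carrier) -> carrier }.
Arguments op {S} A {n} f args : rename.

Definition homomorphism (S : signature) (A B : structure S) (h : A -> B) :=
  forall n (f : S n) (args : 'I_n -> A),
    h (op A f args) = op B f (fun i => h (args i)).

Inductive term (S : signature) (X : Type) : Type :=
| Var of X
| App n of S n & ('I_n -> term S X).
Arguments Var {S X} _.
Arguments App {S X n} _ _.

Definition Fm (S : signature) (X : Type) : structure S :=
  @Structure S (term S X) (@App S X).

Fixpoint eval (S : signature) (X : Type) (A : structure S) (v : X -> A)
    (t : term S X) : A :=
  match t with
  | Var x => v x
  | App n f args => op A f (fun i => eval v (args i))
  end.

Record equation (S : signature) (X : Type) :=
  Equation { lhs : term S X; rhs : term S X }.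

Definition holds (S : signature) (X : Type) (A : structure S) (v : X -> A)
    (e : equation S X) : Prop :=
  eval v (lhs e) = eval v (rhs e).

Record quasi_identity (S : signature) := QuasiIdentity {
  premises : set (equation S nat);
  premises_finite : finite_set premises;
  conclusion : equation S nat }.

Definition satisfies (S : signature) (A : structure S) (q : quasi_identity S) :=
  forall v : nat -> A,
    (forall e, premises q e -> holds v e) -> holds v (conclusion q).

(* Classes of structures are predicates rather than elements of [set _], whose
   universe is too small to contain [structure S]. *)
Definition quasivariety (S : signature) (K : structure S -> Prop) :=
  exists Q : set (quasi_identity S),
    forall A, K A <-> forall q, Q q -> satisfies A q.

Record congruence (S : signature) (A : structure S) := Congruence {
  crel :> A -> A -> Prop;
  crel_refl : forall a, crel a a;
  crel_sym : forall a b, crel a b -> crel b a;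
  crel_trans : forall a b c, crel a b -> crel b c -> crel a c;
  crel_op : forall n (f : S n) (args args' : 'I_n -> A),
    (forall i, crel (args i) (args' i)) -> crel (op A f args) (op A f args') }.

Definition eq_congruence (S : signature) (A : structure S) : congruence A.
Proof.
apply: (@Congruence S A eq) => //; first by move=> a b c ->.
by move=> n f args args' eq_args; congr (op A f _); apply/funext.
Defined.

Section Quotient.
Variables (S : signature) (A : structure S) (theta : congruence A).

Definition brel (a b : {classic A}) : bool := `[< theta a b >].

Lemma brel_refl : reflexive brel.
Proof. by move=> a; apply/asboolP/crel_refl. Qed.

Lemma brel_sym : symmetric brel.
Proof. by move=> a b; apply/asboolP/asboolP; apply: crel_sym. Qed.

Lemma brel_trans : transitive brel.
Proof.
by move=> b a c /asboolP ab /asboolP bc; apply/asboolP/(crel_trans ab bc).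
Qed.

Canonical brel_equiv := EquivRel brel brel_refl brel_sym brel_trans.

Definition quotient_structure : structure S :=
  @Structure S {eq_quot brel_equiv}
    (fun n f args => \pi_({eq_quot brel_equiv}) (op A f (fun i => repr (args i)))).

Definition quotient_map (a : A) : quotient_structure :=
  \pi_({eq_quot brel_equiv}) a.

Lemma quotient_mapP (a b : A) : quotient_map a = quotient_map b <-> theta a b.
Proof.
split=> [/eqmodP /asboolP //|ab].
by apply/eqmodP/asboolP.
Qed.

Lemma quotient_map_hom : homomorphism quotient_map.
Proof.
move=> n f args; apply/quotient_mapP/crel_op => i.
by apply/quotient_mapP; rewrite /quotient_map reprK.
Qed.

End Quotient.

Record Co (S : signature) (K : structure S -> Prop) (A : structure S) := MkCo {
  Co_congruence :> congruence A;
  Co_quotient : K (quotient_structure Co_congruence) }.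

(* Equations in at most one variable are equations over the variable set
   [unit]. *)
Record equational_filter_pair (S : signature) := EquationalFilterPair {
  fp_class : structure S -> Prop;
  fp_quasivariety : quasivariety fp_class;
  fp_eqs : set (equation S unit);
  fp_eqs_finite : finite_set fp_eqs }.

Definition fp_map (S : signature) (P : equational_filter_pair S)
    (A : structure S) (theta : Co (fp_class P) A) : set A :=
  [set a | forall e, fp_eqs P e ->
     theta (eval (fun=> a) (lhs e)) (eval (fun=> a) (rhs e))].

Arguments fp_map {S} P A _ _.

Definition consequence (S : signature) (X : Type) :=
  set (Fm S X) -> Fm S X -> Prop.

Definition fp_logic (S : signature) (P : equational_filter_pair S) (X : Type) :
    consequence S X :=
  fun Gamma phi => forall theta : Co (fp_class P) (Fm S X),
    Gamma `<=` fp_map P _ theta -> fp_map P _ theta phi.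

Arguments fp_logic {S} P X _ _.

Definition logic_filter (S : signature) (X : Type) (l : consequence S X)
    (A : structure S) : set (set A) :=
  [set F | forall (Gamma : set (Fm S X)) (phi : Fm S X) (v : Fm S X -> A),
     l Gamma phi -> homomorphism v -> v @` Gamma `<=` F -> F (v phi)].

Arguments logic_filter {S X} l A _.

Record logic_matrix (S : signature) (X : Type) (l : consequence S X) :=
  LogicMatrix {
    mx_structure : structure S;
    mx_filter : set mx_structure;
    mx_filterP : logic_filter l mx_structure mx_filter }.
Arguments mx_filter {S X l} M _ : rename.

Definition compatible (S : signature) (A : structure S) (theta : congruence A)
    (F : set A) :=
  forall a b, F a -> theta a b -> F b.

Definition is_Leibniz (S : signature) (A : structure S) (F : set A)
    (theta : congruence A) :=
  compatible theta F /\
  forall theta' : congruence A, compatible theta' F ->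
    forall a b, theta' a b -> theta a b.

Definition reduced (S : signature) (X : Type) (l : consequence S X)
    (M : logic_matrix l) :=
  is_Leibniz (mx_filter M) (eq_congruence (mx_structure M)).

Definition truth_equational (S : signature) (X : Type) (l : consequence S X) :=
  exists tau : set (equation S unit),
    forall M : logic_matrix l, reduced M ->
      forall a : mx_structure M,
        mx_filter M a <-> forall e, tau e -> holds (fun=> a) e.

(* Main.v *)
Require Import Defs.
From mathcomp Require Import all_boot.
From mathcomp Require Import all_classical.

(* If F = i_A(theta), then F is a union of theta-classes, because term functions
   respect theta. So theta lies below the Leibniz congruence of F, which is
   equality when the matrix is reduced; hence F is the solution set in A of the
   equations tau of the filter pair, which therefore define truth. *)

Lemma crel_eval (S : signature) (X : Type) (A : structure S)
    (theta : congruence A) (v w : X -> A) (t : term S X) :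
  (forall x, theta (v x) (w x)) -> theta (eval v t) (eval w t).
Proof.
by move=> vw; elim: t => [x|n f args IH] //=; apply: crel_op.
Qed.

Lemma compatible_fp_map (S : signature) (P : equational_filter_pair S)
    (A : structure S) (theta : Co (fp_class P) A) :
  compatible theta (fp_map P A theta).
Proof.
move=> a b Fa ab e Pe.
have eval_ab (t : term S unit) : theta (eval (fun=> a) t) (eval (fun=> b) t).
  by apply: crel_eval.
(* The chain runs through the values of [lhs e] at [b], [lhs e] at [a], [rhs e] at [a], [rhs e] at
   [b]: the middle link is the membership of [a], the outer two come from [theta a b]. *)
apply: (crel_trans _ (crel_trans (Fa e Pe) (eval_ab (rhs e)))).
exact/crel_sym/eval_ab.
Qed.

Theorem proposition3p13 (S : signature) (P : equational_filter_pair S)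
    (X : Type)
    (i_surj : forall A : structure S,
       set_surj setT (logic_filter (fp_logic P X) A) (fp_map P A)) :
  truth_equational (fp_logic P X).
Proof.
exists (fp_eqs P) => -[A F filterF] /= [_ /= Leibniz_eq] a.
have [theta _ defF] := i_surj A F filterF.
rewrite -defF in Leibniz_eq *.
split=> Fa e Pe.
  (* Maximality of equality among the congruences compatible with the filter, applied to [theta],
     turns [theta]-related sides of [e] into equal ones. *)
  exact: (Leibniz_eq _ (compatible_fp_map _ _ _ _)) (Fa e Pe).
by rewrite (Fa e Pe); apply: crel_refl.
Qed.
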